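(* Let $d\ge 2$ and let $E\subset\mathbb{F}_q^d$. Suppose that $\#E\approx q^{\frac{d+1}{2}}$. Then $$\#\Delta(E)\ \gtrsim\ (\#E)^{\frac{2}{d+1}}.$$
   Context: $\mathbb{F}_q$ is the finite field with $q$ elements and $\mathbb{F}_q^d$ is the $d$-dimensional vector space over it. For $x\in\mathbb{F}_q^d$, $|x|^2=x_1^2+\dots+x_d^2\in\mathbb{F}_q$, and $\Delta(E)=\{|x-y|^2: x,y\in E\}\subset\mathbb{F}_q$. $\#$ denotes cardinality. $X\lesssim Y$ means that there exists $C>0$ (independent of $q$ and $E$) such that $X\le CY$; $X\gtrsim Y$ means $Y\lesssim X$; $X\approx Y$ means both $X\lesssim Y$ and $X\gtrsim Y$.
   Formalization: The field is assumed to have odd order q; in characteristic 2 the claim is false, since |x|^2=(x_1+...+x_d)^2 and, e.g. for d>=3, a set E of size about q^{(d+1)/2} in the hyperplane x_1+...+x_d=0 has Delta(E)={0}. *)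

(* Defs.v *)
From HB Require Import structures.
From mathcomp Require Import all_boot all_order all_algebra.

Set Implicit Arguments.
Unset Strict Implicit.
Unset Printing Implicit Defensive.

Import GRing.Theory.
Local Open Scope ring_scope.

Definition sqnorm (F : finFieldType) (d : nat) (x : 'rV[F]_d) : F :=
  \sum_(i < d) x 0 i ^+ 2.

Definition distance_set (F : finFieldType) (d : nat) (E : {set 'rV[F]_d}) :
  {set F} := [set sqnorm (x - y) | x in E, y in E].

(* Main.v *)
Require Import Defs.
From mathcomp Require Import all_boot all_order all_algebra.
From mathcomp Require Import reals exp.
From mathcomp Require Import ring lra.

Import Order.TTheory GRing.Theory Num.Theory.
Local Open Scope ring_scope.

(** Write q for the cardinal of F, and nu(t) for the number of pairs (x, y) in
E x E with |x - y|^2 = t. The nu(t) add up to #E^2 over the distance set D of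
E, so Cauchy-Schwarz gives #E^4 <= #D * M, where M = sum_t nu(t)^2 is the
number of quadruples in E^4 with |x - y|^2 = |z - w|^2
([card_sqr_le_distance_energy]). It remains to bound M by a constant times
#E^4 / q, which is the value it would have if the distances were equidistributed.

Expanding the squares turns the equation into
   2 x.y - 2 z.w = (|x|^2 - |z|^2) + (|y|^2 - |w|^2),
an incidence in F^(2d+1) between a hyperplane depending only on (x, z) and a
point depending only on (y, w) ([incident_lift]); in odd characteristic
distinct pairs give distinct hyperplanes. Thus M is a point-hyperplane
incidence number of two sets of size #E^2.

For an incidence number in F^(n+1), the two-moment argument suffices: a point
lies on a proportion 1/q of all non-vertical hyperplanes, and two distinct points
simultaneously on at most 1/q^2 of them, so the events that a random
hyperplane contains the various points of B are pairwise non-positively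
correlated, and the variance of its number of points in B is at most that of a
sum of independent events ([incidence_variance]). Restricting to a set A of
hyperplanes by Cauchy-Schwarz gives |I - #A #B / q| <= (q^n #A #B)^(1/2)
([incidence_bound]). With n = 2d and #A = #B = #E^2 this is
   q M <= #E^4 + q^(d+1) #E^2 ([distance_energy_le]),
and the exponent (d+1)/2 is exactly the one for which the second term is
dominated by the first: q^(d+1) <= c2^2 #E^2 yields q <= (1 + c2^2) #D
([card_distance_set_ge]). Finally #E^(2/(d+1)) is at most c1^(2/(d+1)) q by the
upper bound on #E. *)

(** * Finite sums and linear forms *)

(** Cauchy-Schwarz against the constant 1, obtained by summing
(a i - a j)^2 >= 0 over all pairs, so that A may be empty. *)
Lemma sqr_sum_le (R : realDomainType) (I : finType) (A : {set I}) (a : I -> R) :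
  (\sum_(i in A) a i) ^+ 2 <= #|A|%:R * \sum_(i in A) a i ^+ 2.
Proof.
have : 0 <= \sum_(i in A) \sum_(j in A) (a i - a j) ^+ 2.
  by apply: sumr_ge0 => i _; apply: sumr_ge0 => j _; apply: sqr_ge0.
set S := \sum_(i in A) a i; set T := \sum_(i in A) a i ^+ 2.
have -> : \sum_(i in A) \sum_(j in A) (a i - a j) ^+ 2
          = 2 * (#|A|%:R * T - S ^+ 2).
  transitivity (\sum_(i in A) (#|A|%:R * a i ^+ 2 - 2 * S * a i + T)).
    apply: eq_bigr => i _.
    rewrite (eq_bigr (fun j => a i ^+ 2 - 2 * a i * a j + a j ^+ 2)); last first.
      by move=> j _; ring.
    rewrite big_split sumrB /= sumr_const -mulr_sumr -/S -/T -mulr_natl.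
    by ring.
  rewrite big_split sumrB /= -!mulr_sumr -/S -/T sumr_const -mulr_natl.
  by ring.
by rewrite pmulr_rge0 // subr_ge0.
Qed.

Lemma sum_setX (I J : finType) (A : {set I}) (B : {set J}) (f : I * J -> nat) :
  (\sum_(e in setX A B) f e = \sum_(i in A) \sum_(j in B) f (i, j))%N.
Proof.
by rewrite pair_big /=; apply: eq_big => [[i j]|[i j] _]; rewrite ?inE.
Qed.

Definition dot {F : fieldType} {n : nat} (u v : 'rV[F]_n) : F :=
  \sum_(i < n) u 0 i * v 0 i.

Section Dot.
Context {F : fieldType}.

Lemma dotDl n (u v w : 'rV[F]_n) : dot (u + v) w = dot u w + dot v w.
Proof. by rewrite -big_split; apply: eq_bigr => i _; rewrite mxE mulrDl. Qed.

Lemma dotZl n a (u v : 'rV[F]_n) : dot (a *: u) v = a * dot u v.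
Proof. by rewrite mulr_sumr; apply: eq_bigr => i _; rewrite mxE mulrA. Qed.

Lemma dotBr n (u v w : 'rV[F]_n) : dot u (v - w) = dot u v - dot u w.
Proof. by rewrite -sumrB; apply: eq_bigr => i _; rewrite !mxE mulrBr. Qed.

Lemma dot_row_mx n m (u v : 'rV[F]_n) (u' v' : 'rV[F]_m) :
  dot (row_mx u u') (row_mx v v') = dot u v + dot u' v'.
Proof.
rewrite /dot big_split_ord; congr (_ + _); apply: eq_bigr => i _;
  by rewrite ?row_mxEl ?row_mxEr.
Qed.

Lemma dot_eq1 n (a : 'rV[F]_n) : a != 0 -> exists u, dot u a = 1.
Proof.
move=> /rV0Pn[i ai0]; exists ((a 0 i)^-1 *: delta_mx 0 i).
rewrite dotZl /dot (bigD1 i) //= big1 ?addr0 => [|j ji].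
  by rewrite mxE !eqxx mul1r mulVf.
by rewrite mxE (negPf ji) andbF mul0r.
Qed.
End Dot.

(** * Point-hyperplane incidences *)

Section Incidence.
Context {F : finFieldType} {n : nat}.
Implicit Types (p r s : 'rV[F]_n * F) (A B : {set 'rV[F]_n * F}).

(** All level sets of a nonzero linear form are translates of one another, and
there are #|F| of them. *)
Lemma card_hyperplane (a : 'rV[F]_n) (b : F) : a != 0 ->
  (#|[set u : 'rV[F]_n | dot u a == b]| * #|F| = #|F| ^ n)%N.
Proof.
move=> /dot_eq1[u0 u01].
pose H c := [set u : 'rV[F]_n | dot u a == c].
have cardH c : #|H c| = #|H b|.
  have -> : H c = [set u + (c - b) *: u0 | u in H b].
    apply/setP => u; rewrite inE; apply/eqP/imsetP => [uc|[v]].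
      exists (u + (b - c) *: u0); last first.
        by rewrite -addrA -scalerDl addrA subrK subrr scale0r addr0.
      by rewrite inE dotDl dotZl u01 uc; apply/eqP; ring.
    by rewrite inE => /eqP vb ->; rewrite dotDl dotZl u01 vb; ring.
  by rewrite card_imset //; apply: addIr.
rewrite -[n in RHS]mul1n -(card_mx F 1 n) -[RHS]sum1_card.
rewrite [RHS](partition_big (fun u => dot u a) predT) //=.
rewrite (eq_bigr (fun=> #|H b|)) => [|c _].
  by rewrite sum_nat_const mulnC.
by rewrite -(cardH c) -sum1_card; apply: eq_bigl => u; rewrite inE.
Qed.

(** The pair (u, c) stands for the non-vertical hyperplane u . X = c + T of
F^n x F, and also for a point of that space. Giving both the same type makes
incidence symmetric and its double counting uniform. *)
Definition incident p r := dot p.1 r.1 == p.2 + r.2.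

Lemma card_incident r : #|[set p | incident p r]| = (#|F| ^ n)%N.
Proof.
have -> : [set p | incident p r] =
    [set (u, dot u r.1 - r.2) | u in [set: 'rV[F]_n]].
  apply/setP => -[u c]; rewrite inE /incident /=; apply/eqP/imsetP => [e|[v _]].
    by exists u; rewrite ?inE // e addrK.
  by case=> -> ->; rewrite subrK.
by rewrite card_imset ?cardsT ?card_mx ?mul1n // => u v [].
Qed.

(** Non-positive correlation. Subtracting the two equations leaves a linear
equation on the direction of the hyperplane, which then determines its
constant; points on a common vertical line share no such hyperplane, and this
is the only case of strict inequality. *)
Lemma card_incident2 r s : r != s ->
  (#|[set p | incident p r && incident p s]| * #|F| <= #|F| ^ n)%N.
Proof.
move=> rs; have [e1|ne1] := eqVneq (r.1 - s.1) 0.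
  rewrite (_ : [set p | _] = set0) ?cards0 //.
  apply/setP => p; rewrite !inE; apply/negP => /andP[/eqP pr /eqP ps].
  move/eqP: e1; rewrite subr_eq0 => /eqP e1; case/negP: rs.
  move: pr; rewrite e1 ps => /addrI e2.
  by case: (r) (s) e1 e2 => [? ?] [? ?] /= -> ->.
rewrite -(card_hyperplane (r.1 - s.1) (r.2 - s.2) ne1) leq_mul2r; apply/orP; right.
rewrite -(card_in_imset (f := fst)).
  apply/subset_leq_card/subsetP => u /imsetP[p].
  rewrite !inE => /andP[/eqP pr /eqP ps] ->.
  by rewrite dotBr pr ps; apply/eqP; ring.
move=> [u c] [v c']; rewrite !inE /incident /= => /andP[/eqP + _] /andP[/eqP + _] uv.
by rewrite uv => -> /addIr ->.
Qed.

(** The variance of the number of points of B on a random hyperplane, scaled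
by #|F| ^ 2 * #|F| ^ n.+1 to avoid division. *)
Lemma incidence_variance (R : realDomainType) B :
  \sum_(p : 'rV[F]_n * F)
    (#|F|%:R * #|[set r in B | incident p r]|%:R - #|B|%:R) ^+ 2
  <= #|F|%:R ^+ (n + 2) * #|B|%:R :> R.
Proof.
set q : R := #|F|%:R; set b : R := #|B|%:R.
pose N p : R := \sum_(r in B) (incident p r)%:R.
have NE p : #|[set r in B | incident p r]|%:R = N p.
  rewrite -sum1_card natr_sum /N big_mkcond [RHS]big_mkcond.
  by apply: eq_bigr => r _; rewrite inE; case: (r \in B) => //; case: incident.
have S1 : \sum_p N p = b * q ^+ n.
  rewrite exchange_big /= (eq_bigr (fun=> q ^+ n)) => [|r _].
    by rewrite sumr_const -mulr_natl.
  rewrite -natrX -(card_incident r) -sum1_card natr_sum big_mkcond.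
  by rewrite [RHS]big_mkcond; apply: eq_bigr => p _; rewrite inE; case: incident.
have S2 : q * \sum_p N p ^+ 2 <= b * q ^+ n.+1 + b ^+ 2 * q ^+ n.
  have -> : \sum_p N p ^+ 2 = \sum_(r in B) \sum_(s in B)
      #|[set p | incident p r && incident p s]|%:R.
    rewrite (eq_bigr (fun p => \sum_(r in B) \sum_(s in B)
      ((incident p r)%:R * (incident p s)%:R))); last first.
      by move=> p _; rewrite expr2 big_distrlr.
    rewrite exchange_big /=; apply: eq_bigr => r _.
    rewrite exchange_big /=; apply: eq_bigr => s _.
    rewrite -sum1_card natr_sum big_mkcond [RHS]big_mkcond.
    by apply: eq_bigr => p _; rewrite inE -natrM mulnb; case: (_ && _).
  have -> : b * q ^+ n.+1 + b ^+ 2 * q ^+ n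
      = \sum_(r in B) (q ^+ n.+1 + b * q ^+ n).
    by rewrite sumr_const -mulr_natl -/b; ring.
  (* The diagonal s = r accounts for the first term, the pairs s != r for the
     second one. *)
  rewrite mulr_sumr; apply: ler_sum => r rB; rewrite (bigD1 r) //= mulrDr.
  apply: lerD.
    rewrite exprS ler_pM2l ?ltr0n; last by apply/card_gt0P; exists 0.
    rewrite -natrX ler_nat -(card_incident r) subset_leq_card //.
    by apply/subsetP => p; rewrite !inE => /andP[].
  have -> : b * q ^+ n = \sum_(s in B) q ^+ n by rewrite sumr_const -mulr_natl.
  rewrite [leRHS](bigD1 r) //= mulr_sumr -[leLHS]add0r.
  apply: lerD; first by rewrite exprn_ge0.
  apply: ler_sum => s /andP[_ sr]; rewrite -natrM -natrX ler_nat mulnC.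
  by apply: card_incident2; rewrite eq_sym.
have -> : \sum_p (q * #|[set r in B | incident p r]|%:R - b) ^+ 2
    = q * (q * \sum_p N p ^+ 2) - 2 * q * b * \sum_p N p + b ^+ 2 * q ^+ n.+1.
  have -> : b ^+ 2 * q ^+ n.+1 = \sum_(p : 'rV[F]_n * F) b ^+ 2.
    by rewrite sumr_const card_prod card_mx mul1n -expnSr -mulr_natr natrX.
  rewrite !mulr_sumr -sumrB -big_split; apply: eq_bigr => p _.
  by rewrite NE /=; ring.
rewrite S1; move: (\sum_p _) S2 => T S2.
have : q * (q * T) <= q * (b * q ^+ n.+1 + b ^+ 2 * q ^+ n).
  by apply: ler_wpM2l.
rewrite addn2 !(exprS q); lra.
Qed.

(** The deviations of the hyperplanes in A alone are controlled by the total
variance, at the cost of a factor #|A| from Cauchy-Schwarz. *)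
Lemma incidence_bound (R : realDomainType) A B :
  (#|F|%:R * (\sum_(p in A) #|[set r in B | incident p r]|)%N%:R
     - #|A|%:R * #|B|%:R) ^+ 2
  <= #|F|%:R ^+ (n + 2) * #|A|%:R * #|B|%:R :> R.
Proof.
have -> : #|F|%:R * (\sum_(p in A) #|[set r in B | incident p r]|)%N%:R
     - #|A|%:R * #|B|%:R =
   \sum_(p in A) (#|F|%:R * #|[set r in B | incident p r]|%:R - #|B|%:R) :> R.
  by rewrite sumrB -mulr_sumr natr_sum sumr_const [#|A|%:R * _]mulr_natl.
apply: le_trans (@sqr_sum_le _ _ _ _) _.
rewrite mulrAC [leRHS]mulrC; apply: ler_wpM2l => //.
apply: le_trans (incidence_variance R B).
rewrite big_mkcond; apply: ler_sum => p _.
by case: ifP => // _; apply: sqr_ge0.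
Qed.
End Incidence.

(** * Distances as incidences *)

Lemma odd_card_two_neq0 (F : finFieldType) : odd #|F| -> 2 != 0 :> F.
Proof.
move=> oF; apply/eqP => F2.
have : #|F|%:R = 0 :> F.
  (* Translation by 1 permutes F, so it preserves the sum of all elements. *)
  apply: (@addrI _ (\sum_(x : F) x)); rewrite addr0.
  by rewrite [RHS](reindex_inj (addIr 1)) /= big_split /= sumr_const.
rewrite -(odd_double_half #|F|) oF -mul2n natrD natrM F2 mul0r addr0 => /eqP.
by rewrite oner_eq0.
Qed.

Section Distances.
Context {F : finFieldType} {d : nat}.
Implicit Types (x y z w : 'rV[F]_d) (E : {set 'rV[F]_d}).

Lemma sqnormB x y : sqnorm (x - y) = sqnorm x - 2 * dot x y + sqnorm y.
Proof.
rewrite /sqnorm /dot mulr_sumr -sumrB -big_split; apply: eq_bigr => i _.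
by rewrite !mxE /=; ring.
Qed.

(** The quadratic terms become the last coordinate, as for points on a
paraboloid; here the quadratic form is |x|^2 - |z|^2 on F^d x F^d, and its
polar form gives the directions in [hyperplane_lift]. *)
Definition point_lift (e : 'rV[F]_d * 'rV[F]_d) : 'rV[F]_(d + d) * F :=
  (row_mx e.1 e.2, sqnorm e.1 - sqnorm e.2).

Definition hyperplane_lift (e : 'rV[F]_d * 'rV[F]_d) : 'rV[F]_(d + d) * F :=
  (row_mx (2 *: e.1) ((- 2) *: e.2), sqnorm e.1 - sqnorm e.2).

Lemma incident_lift x y z w :
  incident (hyperplane_lift (x, z)) (point_lift (y, w))
  = (sqnorm (x - y) == sqnorm (z - w)).
Proof.
rewrite /incident /= dot_row_mx !dotZl !sqnormB.
rewrite -subr_eq0 -[RHS]subr_eq0 -oppr_eq0; congr (_ == _).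
by ring.
Qed.

Lemma point_lift_inj : injective point_lift.
Proof. by move=> [x z] [x' z'] [] /eq_row_mx[-> ->]. Qed.

Lemma hyperplane_lift_inj : 2 != 0 :> F -> injective hyperplane_lift.
Proof.
move=> F2 [x z] [x' z'] [] /eq_row_mx[/scalerI -> // /scalerI -> //].
by rewrite oppr_eq0.
Qed.

(** The second moment of the distance counts, named after the additive energy,
which has x - y = z - w in place of the equality of distances. *)
Definition distance_energy E : nat :=
  \sum_(x in E) \sum_(y in E) \sum_(z in E) \sum_(w in E)
    (sqnorm (x - y) == sqnorm (z - w)).

(** The quadruple (x, y, z, w) is regrouped as (x, z) and (y, w): the equation
couples these two pairs only through a bilinear term. *)
Lemma distance_energy_incidences E : 2 != 0 :> F ->
  distance_energy E = (\sum_(p in hyperplane_lift @: setX E E)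
     #|[set r in point_lift @: setX E E | incident p r]|)%N.
Proof.
move=> F2; have pI := point_lift_inj; have hI := hyperplane_lift_inj F2.
rewrite big_imset /=; last exact: in2W.
rewrite sum_setX; apply: eq_bigr => x _; rewrite exchange_big /=.
apply: eq_bigr => z _.
rewrite -sum1_card [RHS]big_mkcond /=.
rewrite (eq_bigr (fun r => if r \in point_lift @: setX E E then
  incident (hyperplane_lift (x, z)) r : nat else 0%N)); last first.
  by move=> r _; rewrite inE; case: (_ \in _); case: incident.
rewrite -big_mkcond big_imset /=; last exact: in2W.
rewrite sum_setX; apply: eq_bigr => y _; apply: eq_bigr => w _.
by rewrite incident_lift.
Qed.

Lemma distance_energy_le (R : realDomainType) E : odd #|F| ->
  #|F|%:R * (distance_energy E)%:R
  <= #|E|%:R ^+ 4 + #|F|%:R ^+ d.+1 * #|E|%:R ^+ 2 :> R.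
Proof.
move=> /odd_card_two_neq0 F2.
have hI := hyperplane_lift_inj F2; have pI := point_lift_inj.
have := incidence_bound R (hyperplane_lift @: setX E E) (point_lift @: setX E E).
rewrite -distance_energy_incidences // !card_imset // cardsX natrM.
set q : R := #|F|%:R; set e : R := #|E|%:R; set M : R := _%:R.
have -> : q ^+ (d + d + 2) * (e * e) * (e * e) = (q ^+ d.+1 * e ^+ 2) ^+ 2.
  by rewrite !exprD !exprS; ring.
have : 0 <= q ^+ d.+1 * e ^+ 2 by rewrite mulr_ge0 ?exprn_ge0.
set K := q ^+ d.+1 * e ^+ 2 => K0 le_sqr.
have e4 : e ^+ 4 = e * e * (e * e) by ring.
rewrite e4 addrC -lerBlDr leNgt; apply/negP => ltK.
by move: le_sqr; rewrite leNgt ltrXn2r // -?ltrBlDr // K0.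
Qed.

(** Cauchy-Schwarz for the distance counts, whose total is #|E| ^ 2. *)
Lemma card_sqr_le_distance_energy (R : realDomainType) E :
  #|E|%:R ^+ 4 <= #|distance_set E|%:R * (distance_energy E)%:R :> R.
Proof.
pose nu t : nat := (\sum_(x in E) \sum_(y in E) (sqnorm (x - y) == t))%N.
have pick (x y : 'rV[F]_d) (f : F -> nat) : x \in E -> y \in E ->
    (\sum_(t in distance_set E) (sqnorm (x - y) == t) * f t
     = f (sqnorm (x - y)))%N.
  move=> xE yE; rewrite (bigD1 (sqnorm (x - y))) /=; last exact: imset2_f.
  rewrite eqxx mul1n big1 ?addn0 // => t /andP[_ /negPf].
  by rewrite eq_sym => ->.
have nu1 : (\sum_(t in distance_set E) nu t = #|E| ^ 2)%N.
  rewrite exchange_big /= (eq_bigr (fun=> #|E|)) => [|x xE].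
    by rewrite sum_nat_const.
  rewrite exchange_big /= -sum1_card; apply: eq_bigr => y yE.
  by rewrite -[RHS](pick x y (fun=> 1%N)) //; apply: eq_bigr => t _; rewrite muln1.
have nu2 : (\sum_(t in distance_set E) nu t ^ 2 = distance_energy E)%N.
  transitivity (\sum_(t in distance_set E) \sum_(x in E) \sum_(y in E)
                  (sqnorm (x - y) == t) * nu t)%N.
    apply: eq_bigr => t _; rewrite expnS expn1 {1}/nu big_distrl /=.
    by apply: eq_bigr => x _; rewrite big_distrl.
  rewrite exchange_big; apply: eq_bigr => x xE /=.
  rewrite exchange_big; apply: eq_bigr => y yE /=.
  rewrite pick //; apply: eq_bigr => z _; apply: eq_bigr => w _.
  by rewrite eq_sym.
rewrite (exprM _ 2 2) -natrX -nu1 -nu2 !natr_sum.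
under [in leRHS]eq_bigr do rewrite natrX.
exact: sqr_sum_le.
Qed.

(** The hypothesis makes the error term of the energy bound at most c times its
main term, so that a positive proportion of F occurs as distances. *)
Lemma card_distance_set_ge (R : realFieldType) (c : R) E : odd #|F| ->
  E != set0 -> #|F|%:R ^+ d.+1 <= c * #|E|%:R ^+ 2 ->
  #|F|%:R <= (1 + c) * #|distance_set E|%:R :> R.
Proof.
move=> oF; rewrite -card_gt0 -(ltr0n R) => E0 Ebig.
rewrite -(ler_pM2r (exprn_gt0 4 E0)).
apply: le_trans (_ : #|F|%:R * (#|distance_set E|%:R * (distance_energy E)%:R) <= _).
  by apply: ler_wpM2l => //; apply: card_sqr_le_distance_energy.
rewrite mulrCA [leRHS]mulrAC [leRHS]mulrC.
apply: ler_wpM2l => //; apply: le_trans (distance_energy_le R E oF) _.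
rewrite mulrDl mul1r lerD2l.
have -> : c * #|E|%:R ^+ 4 = (c * #|E|%:R ^+ 2) * #|E|%:R ^+ 2 :> R by ring.
by apply: ler_wpM2r Ebig; rewrite exprn_ge0.
Qed.
End Distances.

Theorem corollary1p9 (R : realType) (d : nat) (hd : (2 <= d)%N)
    (c1 c2 : R) (hc1 : 0 < c1) (hc2 : 0 < c2) :
  exists2 C : R, 0 < C &
    forall (F : finFieldType) (E : {set 'rV[F]_d}),
      odd #|F| ->
      #|E|%:R <= c1 * #|F|%:R `^ ((d%:R + 1) / 2) ->
      #|F|%:R `^ ((d%:R + 1) / 2) <= c2 * #|E|%:R ->
      #|E|%:R `^ (2 / (d%:R + 1)) <= C * #|distance_set E|%:R.
Proof.
(* The first factor converts #|E| into #|F|; the second is the loss when the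
   error term of the energy bound is c2 ^+ 2 times its main term. *)
exists (c1 `^ (2 / (d%:R + 1)) * (1 + c2 ^+ 2)).
  by rewrite mulr_gt0 ?powR_gt0 // ltr_pwDl // sqr_ge0.
move=> F E oF Eup Elow.
have d1 : 0 < d%:R + 1 :> R by rewrite ltr_wpDl.
have q0 : 0 < #|F|%:R :> R by rewrite ltr0n; apply/card_gt0P; exists 0.
have E0 : E != set0.
  apply/eqP => E0; move: Elow; rewrite E0 cards0 mulr0 leNgt.
  by rewrite powR_gt0.
have qE : #|F|%:R <= (1 + c2 ^+ 2) * #|distance_set E|%:R :> R.
  apply: card_distance_set_ge => //; rewrite -exprMn.
  apply: le_trans (_ : (#|F|%:R `^ ((d%:R + 1) / 2)) ^+ 2 <= _).
    by rewrite -powR_mulrn ?powR_ge0 // -powRrM divfK ?pnatr_eq0 //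
       -(natrD _ d 1) addn1 powR_mulrn // ltW.
  by rewrite lerXn2r ?nnegrE ?powR_ge0 // mulr_ge0 // ltW.
have -> : 2 / (d%:R + 1) = ((d%:R + 1) / 2)^-1 :> R by rewrite invf_div.
set a := (d%:R + 1) / 2 in Eup *.
have a0 : 0 < a by rewrite divr_gt0.
clearbody a.
apply: le_trans (_ : (c1 * #|F|%:R `^ a) `^ a^-1 <= _).
  by apply: ge0_ler_powR; rewrite ?nnegrE ?invr_ge0 ?mulr_ge0 ?powR_ge0 // ltW.
rewrite powRM ?powR_ge0 //; last exact: ltW.
by rewrite -powRrM divff ?gt_eqF // powRr1 // -mulrA ler_wpM2l ?powR_ge0.
Qed.
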